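(* Let $G=(V,E)$ be a finite graph, let $x$ be a number, and let $w(G)$ be the couple game given by $w(\emptyset)=0$ and $w(A)=1$ for each $\emptyset\neq A\subseteq E$. Let $a\in E$. Then the Shapley value of $a$ in $w(G)$ satisfies $$\phi_a(w(G))=C(G.a,x),$$ where $G.a$ is $G$ with the edge $a$ contracted and $C$ is the chromatic polynomial.
   Context: Graphs are finite; loops and multiple edges are allowed. ''Number'' may be read as complex number. The symbol $\subseteq$ allows equality. Components: for a graph $(V,E)$ and $A\subseteq E$, $c(A)$ is the number of connected components of $(V,A)$. Games: a cooperative game with finite player set $N$ is a function $v:2^N\to\mathbb{C}$ with $v(\emptyset)=0$; here the players are the edges of $G$. For $R\subseteq N$ put $c_R(v)=\sum_{T\subseteq R}(-1)^{|R|-|T|}v(T)$. Connectivity augmentation: for $\emptyset\neq R\subseteq E$, the basic connectivity augmented game is $b(R,G,x)(S)=|R|x^{c(R)}$ if $R\subseteq S\subseteq E$, and $0$ otherwise. The connectivity augmented game of $w$ is $w(G)=\sum_{\emptyset\neq R\subseteq E}c_R(w)\,b(R,G,x)$. It is called a couple game when $w(A)=\prod_{e\in A}w(\{e\})$ for all $\emptyset\ne A\subseteq E$. Shapley value: for a game $v$ on $N$ and a player $e\in N$, $\phi_e(v)=\sum_{e\in R\subseteq N}\frac{1}{|R|}c_R(v)$. Chromatic polynomial: for a graph $H=(V_H,E_H)$, $C(H,x)=\sum_{A\subseteq E_H}(-1)^{|A|}x^{c(A)}$, with $c(A)$ the number of connected components of $(V_H,A)$. Contraction: $G.a$ is the graph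 whose vertices are the connected components of $(V,\{a\})$ and which has exactly one edge for each $e\in E\setminus\{a\}$, joining the components containing the ends of $e$ (so loops and multiple edges may occur). *)

(* Defs.v *)
From mathcomp Require Import all_boot all_order all_algebra.

Set Implicit Arguments.
Unset Strict Implicit.
Unset Printing Implicit Defensive.

Import GRing.Theory.
Local Open Scope ring_scope.

(* A finite multigraph: several edges may have the same ends, and an edge e
   with (ends e).1 = (ends e).2 is a loop.  The order of the two ends of an
   edge carries no meaning: it is forgotten by [adj]. *)
Record multigraph := Multigraph {
  vertex : finType;
  edge : finType;
  ends : edge -> vertex * vertex
}.

Section Components.
Variable G : multigraph.
Implicit Types (A : {set edge G}) (u v : vertex G).

Definition adj A : rel (vertex G) := fun u v =>
  [exists e in A, (ends e == (u, v)) || (ends e == (v, u))].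

Definition component A v : {set vertex G} := [set u | connect (adj A) v u].

Definition components A : {set {set vertex G}} :=
  [set component A v | v : vertex G].

Definition ncomp A : nat := #|components A|.

Lemma component_in A v : component A v \in components A.
Proof. exact: imset_f. Qed.

Lemma connect_adj_sym A : connect_sym (adj A).
Proof.
apply: sym_connect_sym => u v.
by apply: eq_existsb => e; rewrite orbC.
Qed.

Lemma ncompE A : ncomp A = n_comp (adj A) predT.
Proof.
have cs := connect_adj_sym A.
rewrite -[RHS](@card_in_imset _ _ (component A)).
  apply: eq_card => B; apply/imsetP/imsetP => [[v _ ->]|[v _ ->]]; last by exists v.
  exists (fingraph.root (adj A) v); first by rewrite !inE roots_root.
  apply/setP => u; rewrite !inE; apply: same_connect => //; exact: connect_root.
move=> u v; rewrite !inE !andbT => /eqP ru /eqP rv /setP /(_ v).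
by rewrite !inE connect0 => /(fingraph.rootP cs); rewrite ru rv.
Qed.

End Components.

Section Contraction.
Variables (G : multigraph) (a : edge G).

Definition contract_vertex : finType :=
  {B : {set vertex G} | B \in components [set a]}.

Definition contract_edge : finType := {e : edge G | e != a}.

Definition contract_proj (v : vertex G) : contract_vertex :=
  exist _ (component [set a] v) (component_in [set a] v).

Definition contract : multigraph :=
  @Multigraph contract_vertex contract_edge (fun e =>
    (contract_proj (ends (val e)).1, contract_proj (ends (val e)).2)).

End Contraction.

Definition chromatic (F : fieldType) (H : multigraph) (x : F) : F :=
  \sum_(A : {set edge H}) (-1) ^+ #|A| * x ^+ ncomp A.

Record game (F : fieldType) (N : finType) := Game {
  worth :> {set N} -> F;
  worth0 : worth set0 = 0
}.

Section Games.
Variables (F : fieldType) (N : finType).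
Implicit Types (v w : game F N) (R T : {set N}) (e : N).

Definition coef R v : F :=
  \sum_(T : {set N} | T \subset R) (-1) ^+ (#|R| - #|T|) * v T.

(* Meaningful only when F has characteristic 0 (inverses of cardinals). *)
Definition shapley e v : F :=
  \sum_(R : {set N} | e \in R) (#|R|%:R)^-1 * coef R v.

(* The condition on w under which its connectivity augmented game on a graph
   with edge set N is called a couple game. *)
Definition couple w : Prop :=
  forall A : {set N}, A != set0 -> w A = \prod_(e in A) w [set e].

Lemma couple_one w :
  (forall A : {set N}, A != set0 -> w A = 1) -> couple w.
Proof.
move=> w1 A A0; rewrite w1 // big1 // => e _.
by rewrite w1 //; apply/set0Pn; exists e; rewrite inE.
Qed.

End Games.

Section Augmentation.
Variables (F : fieldType) (G : multigraph) (x : F).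
Implicit Types (R S : {set edge G}) (w : game F (edge G)).

Definition basic_worth R S : F :=
  if R \subset S then #|R|%:R * x ^+ ncomp R else 0.

Lemma basic_worth0 R : basic_worth R set0 = 0.
Proof.
rewrite /basic_worth subset0; case: eqP => // ->.
by rewrite cards0 mul0r.
Qed.

(* Only used for nonempty R; for R = set0 it is the zero game. *)
Definition basic R : game F (edge G) := Game (basic_worth0 R).

Definition augmented_worth w S : F :=
  \sum_(R : {set edge G} | R != set0) coef R w * basic R S.

Lemma augmented_worth0 w : augmented_worth w set0 = 0.
Proof. by rewrite /augmented_worth big1 // => R _; rewrite worth0 mulr0. Qed.

Definition augmented w : game F (edge G) := Game (augmented_worth0 w).

End Augmentation.

Arguments basic {F} G x R.
Arguments augmented {F} G x w.

(* Main.v *)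
(** Toggling one player kills the alternating sum of a non-degenerate interval
of coalitions, so the dividend of [R] in the augmented game is
[(-1)^(|R|-1) |R| x^c(R)] and the Shapley value is the sum of
[(-1)^(|R|-1) x^c(R)] over the edge sets [R] containing [a].  Sending [B] to
[a |: B] identifies these with the edge sets of the contraction, and since two
vertices are linked by [a |: B] exactly when their [a]-components are linked by
[B], the numbers of components agree. *)
Require Import Defs.
From mathcomp Require Import all_boot all_order all_algebra.
From mathcomp Require Import reals complex.

Import GRing.Theory.
Local Open Scope ring_scope.

Lemma alternating_sum_interval (F : pzRingType) (N : finType) (R S : {set N}) :
  R \subset S ->
  \sum_(T : {set N} | (T \subset S) && (R \subset T)) (-1) ^+ (#|S| - #|T|)
    = (R == S)%:R :> F.
Proof.
move=> RS; case: eqVneq => [->|RneS].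
  rewrite (big_pred1 S) ?subnn // => T; exact/esym/eqEsubset.
have /properP [_ [e eS eR]] : R \proper S by rewrite properEneq RneS.
rewrite (bigID (fun T : {set N} => e \in T)) /=.
(* Since [e] lies in [S] but not in [R], a coalition [T] avoiding [e] is in the interval exactly
   when [e |: T] is; the two halves of the sum are matched this way and have opposite signs. *)
rewrite (reindex_onto (fun T => e |: T) (fun T => T :\ e)) /=; last first.
  by move=> T /andP [_ eT]; rewrite setD1K.
rewrite -[X in _ + X]opprK -sumrN; apply/eqP; rewrite subr_eq0; apply/eqP.
apply: eq_big => T.
  rewrite setU11 andbT subUset sub1set eS /=.
  case eT: (e \in T) => /=; last first.
    by rewrite setU1K ?eT // eqxx !andbT -subDset (setDidPl _) // disjoint_sym disjoints1.
  rewrite andbF; apply/negP => /andP [_ /eqP eTE].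
  by move: eT; rewrite -eTE !inE eqxx.
case/andP=> /andP [/andP [sub _] _] /eqP eTE.
have eT : e \notin T by rewrite -eTE !inE eqxx.
move/subset_leq_card: sub; rewrite cardsU1 eT add1n => ltTS.
(* The subtraction is truncated: [ltTS] makes the exponent positive, so lowering it by one really
   flips the sign. *)
by rewrite -[(#|S| - #|T|)%N]prednK ?subn_gt0 // -subnS exprS mulN1r opprK.
Qed.

Section Dividends.
Variables (F : fieldType) (G : multigraph) (x : F).
Implicit Types (w : game F (edge G)) (R S : {set edge G}).

(** [basic G x R] is a multiple of the unanimity game of [R], whose only nonzero dividend sits at
    [R]. *)
Lemma coef_basic R S :
  coef S (basic G x R) = (R == S)%:R * (#|R|%:R * x ^+ ncomp R).
Proof.
rewrite /coef /= /basic_worth.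
rewrite (bigID (fun T : {set edge G} => R \subset T)) /= [X in _ + X]big1 ?addr0; last first.
  by move=> T /andP [_ /negbTE ->]; rewrite mulr0.
under eq_bigr => T /andP [_ RT] do rewrite RT.
rewrite -big_distrl /=; have [RS|RS] := boolP (R \subset S).
  by rewrite alternating_sum_interval.
rewrite big_pred0 => [|T].
  by case: eqVneq RS => [->|_ _]; rewrite ?subxx ?mul0r.
by apply: contraNF RS => /andP [TS RT]; apply: subset_trans TS.
Qed.

(** Dividends are linear in the game, so only the basic game of [S] itself contributes. *)
Lemma coef_augmented w S : S != set0 ->
  coef S (augmented G x w) = coef S w * (#|S|%:R * x ^+ ncomp S).
Proof.
move=> S0; transitivity (\sum_(R | R != set0) coef R w * coef S (basic G x R)).
  rewrite /coef /= /augmented_worth; under eq_bigr do rewrite mulr_sumr.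
  rewrite exchange_big /=; apply: eq_bigr => R _; rewrite [RHS]mulr_sumr.
  by apply: eq_bigr => T _; rewrite mulrCA.
rewrite (bigD1 S) //= coef_basic eqxx mul1r big1 ?addr0 // => R /andP [_ RS].
by rewrite coef_basic (negbTE RS) mul0r mulr0.
Qed.

(** The full alternating sum over the subsets of [S] vanishes; [w] differs from the constant 1 only
    at [set0], so the missing term is what remains, negated. *)
Lemma coef_one w (w_one : forall A, A != set0 -> w A = 1) S :
  S != set0 -> coef S w = - (-1) ^+ #|S|.
Proof.
move=> S0; rewrite /coef (bigD1 set0) ?sub0set //= worth0 mulr0 add0r.
have := @alternating_sum_interval F _ _ _ (sub0set S).
rewrite eq_sym (negbTE S0) (bigD1 set0) ?sub0set //= cards0 subn0 => /eqP.
rewrite addrC addr_eq0 => /eqP <-; apply: eq_big => T; first by rewrite sub0set andbT.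
by case/andP=> _ /w_one ->; rewrite mulr1.
Qed.

End Dividends.

Section Contraction.
Variables (G : multigraph) (a : edge G).
Implicit Types (B : {set edge (contract a)}) (u v : vertex G).

Definition uncontract B : {set edge G} := a |: [set val e | e in B].

Lemma notin_val_imset B : a \notin [set val e | e in B].
Proof. by apply/imsetP => -[e _ ae]; have := valP e; rewrite -ae eqxx. Qed.

Lemma card_uncontract B : #|uncontract B| = #|B|.+1.
Proof.
by rewrite cardsU1 notin_val_imset card_imset //; apply: val_inj.
Qed.

Lemma uncontractK :
  cancel uncontract (fun A => [set e : edge (contract a) | val e \in A]).
Proof.
move=> B; apply/setP => e; rewrite !inE (negbTE (valP e)) /=.
by rewrite mem_imset //; apply: val_inj.
Qed.

Lemma contractK (A : {set edge G}) : a \in A ->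
  uncontract [set e : edge (contract a) | val e \in A] = A.
Proof.
move=> aA; apply/setP => e; rewrite !inE; case: eqVneq => [->|ea] //=.
apply/imsetP/idP => [[f]|eA]; first by rewrite inE => fA ->.
by exists (exist _ e ea); rewrite ?inE.
Qed.

Lemma adj_mem (H : multigraph) (A : {set edge H}) e :
  e \in A -> adj A (ends e).1 (ends e).2.
Proof. by move=> eA; apply/existsP; exists e; rewrite eA -surjective_pairing eqxx. Qed.

Lemma contract_projP u v :
  reflect (contract_proj a u = contract_proj a v) (connect (adj [set a]) u v).
Proof.
apply: (iffP idP) => [uv|/(congr1 val)/setP/(_ v)]; last by rewrite !inE connect0.
apply/val_inj/setP => y; rewrite !inE.
exact/same_connect/uv/connect_adj_sym.
Qed.

Lemma contract_proj_surj (U : vertex (contract a)) : exists u, contract_proj a u = U.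
Proof.
by case/imsetP: (valP U) => u _ uU; exists u; apply: val_inj.
Qed.

(** Projecting a path, a step along [a] collapses to a point and any other step survives. Lifting a
    path, consecutive lifted edges need not share an end, only an [a]-component; [sub_a] bridges
    these gaps. *)
Lemma connect_uncontract B u v :
  connect (adj (uncontract B)) u v
    = connect (adj B) (contract_proj a u) (contract_proj a v).
Proof.
have cs := connect_adj_sym.
apply/idP/idP => [/connectP [p]|/connectP [p]].
  elim: p u => [|y p IHp] u /= => [_ -> //|/andP [uy py] lv].
  apply: connect_trans (IHp _ py lv).
  case/existsP: uy => e /andP [/setU1P [-> auy|/imsetP [f fB ->] fuy]].
    suff /contract_projP -> : connect (adj [set a]) u y by [].
    by apply: connect1; apply/existsP; exists a; rewrite inE eqxx.
  have := adj_mem (contract a) B f fB => /= /connect1.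
  by case/orP: fuy => /eqP -> //=; rewrite (connect_adj_sym B).
have sub_a y z : contract_proj a y = contract_proj a z ->
    connect (adj (uncontract B)) y z.
  move/contract_projP; apply: connect_sub => {}y {}z /existsP [e /andP [ea yz]].
  apply: connect1; apply/existsP; exists e; rewrite yz andbT.
  by move: ea; rewrite !inE => ->.
elim: p u => [|Y p IHp] u /= => [_ /esym/sub_a //|/andP [uY pY] lv].
have [y yY] := contract_proj_surj Y; subst Y.
apply: connect_trans (IHp _ pY lv).
case/existsP: uY => e /andP [eB].
have /connect1 pq : adj (uncontract B) (ends (val e)).1 (ends (val e)).2.
  by apply: adj_mem; apply/setU1P; right; apply: imset_f.
(* The edge may be crossed in either direction, hence two cases. *)
case/orP=> /eqP pqE; have up := sub_a _ _ (congr1 fst pqE);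
  have qy := sub_a _ _ (congr1 snd pqE).
  apply: connect_trans (connect_trans pq qy); by rewrite cs.
by apply: connect_trans up; rewrite cs; apply: connect_trans pq _.
Qed.

(** The projection is onto and both preserves and reflects connectedness, so it is an adjunction of
    relations and induces a bijection of components. *)
Lemma ncomp_uncontract B : ncomp (uncontract B) = ncomp B.
Proof.
rewrite !ncompE; symmetry.
apply: (@adjunction_n_comp _ _ (contract_proj a)) => //.
- exact: (@connect_adj_sym (contract a)).
- exact: connect_adj_sym.
split=> [U _|u v _]; last exact: connect_uncontract.
(* The adjunction asks for an explicit preimage, which [sigW] chooses from the mere existence. *)
apply: sigW; have [u <-] := contract_proj_surj U; by exists u.
Qed.

End Contraction.

Theorem theorem13 (R : realType) (G : multigraph) (x : R[i])
    (w : game R[i] (edge G))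
    (w_one : forall A : {set edge G}, A != set0 -> w A = 1)
    (a : edge G) :
  shapley a (augmented G x w) = chromatic (contract a) x.
Proof.
rewrite /shapley /chromatic.
rewrite (reindex_onto (@uncontract G a) _ (@contractK G a)) /=.
apply: eq_big => [B|B _]; first by rewrite setU11 uncontractK eqxx.
have B0 : uncontract G a B != set0 by rewrite -card_gt0 card_uncontract.
rewrite coef_augmented // coef_one // ncomp_uncontract card_uncontract.
(* In characteristic 0 the factor [#|B|.+1] cancels the Shapley weight, and the extra edge [a]
   absorbs the minus sign of [coef_one]. *)
by rewrite mulrCA mulKf ?Num.Theory.pnatr_eq0 // exprS mulN1r opprK.
Qed.
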